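(* Let $M$ and $N$ be two quasianalytic weight sequences and assume $\sup_{k\in\mathbb N_{>0}}n_k^{1/k}=+\infty$ (Roumieu case) resp. $\lim_{k\to+\infty}n_k^{1/k}=+\infty$ (Beurling case). Then $\Lambda^r_{[N]}\setminus j^\infty(\mathcal E^{0,r}_{\{M\}})$ is lineable in $\Lambda^r_{[N]}$ (and hence so is $\Lambda^r_{[N]}\setminus j^\infty(\mathcal E^{0,r}_{(M)})$).
   Context: For a sequence $M=(M_p)_{p\in\mathbb N}$ of positive reals write $m_p:=M_p/p!$ (and $n_p:=N_p/p!$). $M$ is a weight sequence if $1=M_0\le M_1$, $M_p^2\le M_{p-1}M_{p+1}$ for all $p\ge1$, and $\liminf_{p\to\infty}m_p^{1/p}>0$; it is quasianalytic if $\sum_{p\ge1}M_{p-1}/M_p=+\infty$. For $U\subseteq\mathbb R^r$ open, $K\subseteq U$ compact, $h>0$: $\|f\|^M_{K,h}:=\sup_{\alpha\in\mathbb N^r,x\in K}|\partial^\alpha f(x)|/(h^{|\alpha|}M_{|\alpha|})$. $\mathcal E_{\{M\}}(U)$ consists of smooth $f$ such that for every compact $K\subseteq U$ there exists $h>0$ with $\|f\|^M_{K,h}<\infty$; $\mathcal E_{(M)}(U)$: for every compact $K$ and every $h>0$. $\mathcal E^{0,r}_{\{M\}}$, $\mathcal E^{0,r}_{(M)}$ are the spaces of germs at $0\in\mathbb R^r$ of functions in the respective class on some cube $(-1/k,1/k)^r$. For $\mathbf b=(b_\alpha)_{\alpha\in\mathbb N^r}$ and $h>0$: $|\mathbf b|^N_h:=\sup_\alpha|b_\alpha|/(h^{|\alpha|}n_{|\alpha|})$;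 $\Lambda^r_{\{N\}}:=\{\mathbf b:\exists h>0,|\mathbf b|^N_h<\infty\}$, $\Lambda^r_{(N)}:=\{\mathbf b:\forall h>0,|\mathbf b|^N_h<\infty\}$. The Borel map is $j^\infty(f)=(\partial^\alpha f(0)/|\alpha|!)_{\alpha\in\mathbb N^r}$. The notation $[\cdot]$ means either $\{\cdot\}$ throughout (Roumieu) or $(\cdot)$ throughout (Beurling). A subset $L$ of a vector space $X$ is lineable if $L\cup\{0\}$ contains an infinite-dimensional vector subspace. *)

(* Defs.v *)
From Stdlib Require Import Reals Lra Lia Arith.
Open Scope R_scope.

Definition msmall (M : nat -> R) (p : nat) : R := M p / INR (fact p).

Definition mroot (M : nat -> R) (p : nat) : R := Rpower (msmall M p) (/ INR p).

Definition weight_sequence (M : nat -> R) : Prop :=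
  (forall p, 0 < M p) /\
  M 0%nat = 1 /\ M 0%nat <= M 1%nat /\
  (forall p, (1 <= p)%nat -> (M p) ^ 2 <= M (p - 1)%nat * M (p + 1)%nat) /\
  (exists c, 0 < c /\ exists p0, forall p, (p0 <= p)%nat -> (1 <= p)%nat ->
        c <= mroot M p).

Definition quasianalytic (M : nat -> R) : Prop :=
  forall B : R, exists n : nat,
    B < sum_f_R0 (fun k => M k / M (S k)) n.

(* A point of R^r is a function x : nat -> R whose coordinates >= r vanish. *)
Definition upd (x : nat -> R) (i : nat) (t : R) : nat -> R :=
  fun j => if Nat.eqb j i then t else x j.

Definition zero_pt : nat -> R := fun _ => 0.

Definition open_cube (r : nat) (rho : R) (x : nat -> R) : Prop :=
  forall i, ((i < r)%nat -> Rabs (x i) < rho) /\ ((r <= i)%nat -> x i = 0).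
Definition closed_cube (r : nat) (rho : R) (x : nat -> R) : Prop :=
  forall i, ((i < r)%nat -> Rabs (x i) <= rho) /\ ((r <= i)%nat -> x i = 0).

Definition valid_mi (r : nat) (a : nat -> nat) : Prop :=
  forall i, (r <= i)%nat -> a i = 0%nat.

Definition mindex (r : nat) : Type := {a : nat -> nat | valid_mi r a}.

Fixpoint nsum (a : nat -> nat) (n : nat) : nat :=
  match n with O => O | S n' => (nsum a n' + a n')%nat end.

Definition mabs (r : nat) (a : nat -> nat) : nat := nsum a r.

Definition incr (a : nat -> nat) (i : nat) : nat -> nat :=
  fun j => if Nat.eqb j i then S (a j) else a j.

(** * Smooth functions on an open cube, with their partial derivatives.
    [D a] is the partial derivative d^a f; [D (fun _ => 0)] is f itself.
    D is required to consist of continuous functions on the cube such that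
    d/dx_i (D a) = D (a + e_i) for all i < r, i.e. f is C^oo with
    partial derivatives D. *)
Definition smooth_derivs (r : nat) (rho : R) (D : (nat -> nat) -> (nat -> R) -> R)
  : Prop :=
  (forall a, valid_mi r a -> forall i, (i < r)%nat -> forall x, open_cube r rho x ->
      derivable_pt_lim (fun t => D a (upd x i t)) (x i) (D (incr a i) x)) /\
  (forall a, valid_mi r a -> forall x, open_cube r rho x ->
      forall eps, 0 < eps -> exists delta, 0 < delta /\
        forall y, open_cube r rho y ->
          (forall i, (i < r)%nat -> Rabs (y i - x i) < delta) ->
          Rabs (D a y - D a x) < eps).

(** [roum = true]: Roumieu case {.}; [roum = false]: Beurling case (.). *)
Definition quant_h (roum : bool) (P : R -> Prop) : Prop :=
  if roum then exists h, 0 < h /\ P h else forall h, 0 < h -> P h.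

(* Germs at 0 of functions in E_[M]: given by f = D 0 on some cube
   (-1/k,1/k)^r, smooth there, with ||f||^M_{K,h} finite for every compact
   K of the cube (K ranging over the exhausting closed subcubes [-rho,rho]^r). *)
Definition germ_class (r : nat) (M : nat -> R) (roum : bool)
  (k : nat) (D : (nat -> nat) -> (nat -> R) -> R) : Prop :=
  (1 <= k)%nat /\ smooth_derivs r (/ INR k) D /\
  forall rho, 0 < rho < / INR k ->
    quant_h roum (fun h => exists C, forall a, valid_mi r a ->
      forall x, closed_cube r rho x ->
        Rabs (D a x) <= C * (h ^ (mabs r a) * M (mabs r a))).

Definition jet (r : nat) (D : (nat -> nat) -> (nat -> R) -> R) : mindex r -> R :=
  fun al => D (proj1_sig al) zero_pt / INR (fact (mabs r (proj1_sig al))).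

Definition in_jet_image (r : nat) (M : nat -> R) (roum : bool) (b : mindex r -> R)
  : Prop :=
  exists k D, germ_class r M roum k D /\ b = jet r D.

Definition Lambda (r : nat) (N : nat -> R) (roum : bool) (b : mindex r -> R) : Prop :=
  quant_h roum (fun h => exists C, forall al : mindex r,
    Rabs (b al) <= C * (h ^ (mabs r (proj1_sig al)) * msmall N (mabs r (proj1_sig al)))).

Definition vzero {T : Type} : T -> R := fun _ => 0.

Definition is_subspace {T : Type} (V : (T -> R) -> Prop) : Prop :=
  V vzero /\
  (forall u v, V u -> V v -> V (fun t => u t + v t)) /\
  (forall c u, V u -> V (fun t => c * u t)).

Fixpoint lincomb {T : Type} (c : nat -> R) (v : nat -> T -> R) (n : nat) : T -> R :=
  match n with
  | O => vzero
  | S n' => fun t => lincomb c v n' t + c n' * v n' t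
  end.

Definition lin_indep {T : Type} (v : nat -> T -> R) (n : nat) : Prop :=
  forall c : nat -> R, lincomb c v n = vzero -> forall i, (i < n)%nat -> c i = 0.

Definition infinite_dim {T : Type} (V : (T -> R) -> Prop) : Prop :=
  forall n : nat, exists v : nat -> T -> R,
    (forall i, (i < n)%nat -> V (v i)) /\ lin_indep v n.

Definition lineable {T : Type} (L : (T -> R) -> Prop) : Prop :=
  exists V : (T -> R) -> Prop,
    is_subspace V /\ infinite_dim V /\ (forall v, V v -> L v \/ v = vzero).

(* Main.v *)
(** Restricting a germ to the first coordinate axis reduces everything to
    one variable.  Let [w k] be [n_k] (Roumieu) or [sqrt n_k] (Beurling), and
    consider the jets supported on the multi-indices [k e_1] with values
    [w k * sum_i c_i (2^i)^k], where [c] has finite support.  They belong to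
    [Lambda], and a nonzero one has eventually constant sign, since the
    largest exponential dominates.

    Such a jet cannot come from a quasianalytic germ.  Bang's argument for the
    Denjoy-Carleman theorem, run with the negative parts of the derivatives
    only, shows that a function all of whose derivatives of order [>= K] are
    nonnegative at 0 keeps nonnegative derivatives of these orders on an
    interval [[0, rho]].  Taylor's formula then bounds the derivatives at 0
    geometrically, whereas [w k] is not bounded by any [C * A^k]. *)

Require Import Defs.
From Stdlib Require Import Reals.
From Stdlib Require Import Arith Lra Lia Classical FunctionalExtensionality.
Open Scope R_scope.

(** * Calculus of derivative towers on an interval *)

(** Derivatives are two-sided even at the end points; the towers used below come from a larger open
    interval. *)
Definition derivative_tower (g : nat -> R -> R) (a b : R) : Prop :=
  forall n t, a <= t <= b -> derivable_pt_lim (g n) t (g (S n) t).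

Lemma derivable_pt_lim_le (f f' : R -> R) (a b : R) :
  a <= b ->
  (forall t, a <= t <= b -> derivable_pt_lim f t (f' t)) ->
  (forall t, a <= t <= b -> 0 <= f' t) -> f a <= f b.
Proof.
intros ab df f'0.
destruct (Req_dec a b) as [->|nab]; [lra|].
destruct (MVT_cor2 f f' a b) as [c [e hc]]; [lra|exact df|].
assert (0 <= f' c * (b - a)) by (apply Rmult_le_pos; [apply f'0; lra|lra]).
lra.
Qed.

Lemma derivable_pt_lim_scal_exp (A k x t : R) :
  derivable_pt_lim (fun u => A * exp (k * (u - x))) t
    (A * k * exp (k * (t - x))).
Proof.
replace (A * k * exp (k * (t - x))) with (A * (exp (k * (t - x)) * (k * (1 - 0))))
  by ring.
apply (derivable_pt_lim_scal (fun u => exp (k * (u - x)))).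
apply (derivable_pt_lim_comp (fun u => k * (u - x)) exp).
- apply (derivable_pt_lim_scal (fun u => u - x)).
  apply (derivable_pt_lim_minus id (fun _ => x)).
  + apply derivable_pt_lim_id.
  + apply derivable_pt_lim_const.
- apply derivable_pt_lim_exp.
Qed.

(** Taylor's formula with nonnegative terms, without a remainder: by induction applied to the
    shifted tower, subtracting the monomial of degree [n] from [g 0] leaves a nondecreasing
    function, which starts at a nonnegative value. *)
Lemma taylor_term_le (n : nat) (g : nat -> R -> R) (rho : R) :
  derivative_tower g 0 rho ->
  (forall k t, 0 <= t <= rho -> 0 <= g k t) ->
  forall t, 0 <= t <= rho -> g n 0 * t ^ n / INR (fact n) <= g 0%nat t.
Proof.
revert g; induction n as [|n IH]; intros g dg g0 t ht.
- simpl.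
  replace (g 0%nat 0 * 1 / 1) with (g 0%nat 0) by field.
  apply derivable_pt_lim_le with (f' := g 1%nat); [lra| |].
  + intros u hu; apply dg; lra.
  + intros u hu; apply g0; lra.
(* With this [c], the derivative of [c * u ^ S n] is exactly the term that the induction hypothesis
   bounds by [g 1 u]. *)
- set (c := g (S n) 0 / INR (fact (S n))).
  assert (H : g 0%nat 0 - c * 0 ^ S n <= g 0%nat t - c * t ^ S n).
  { apply derivable_pt_lim_le with
      (f := fun u => g 0%nat u - c * u ^ S n)
      (f' := fun u => g 1%nat u - c * (INR (S n) * u ^ n)); [lra| |].
    - intros u hu.
      apply (derivable_pt_lim_minus (g 0%nat) (fun v => c * v ^ S n)).
      + apply dg; lra.
      + apply (derivable_pt_lim_scal (fun v => v ^ S n)).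
        apply (derivable_pt_lim_pow u (S n)).
    - intros u hu.
      assert (H := IH (fun k => g (S k)) (fun k s hs => dg (S k) s hs)
                     (fun k s hs => g0 (S k) s hs) u ltac:(lra)).
      cbv beta in H.
      replace (c * (INR (S n) * u ^ n)) with (g (S n) 0 * u ^ n / INR (fact n)).
      + lra.
      + unfold c; rewrite fact_simpl, mult_INR; field; split.
        * apply INR_fact_neq_0.
        * apply not_0_INR; lia. }
  assert (0 <= g 0%nat 0) by (apply g0; lra).
  rewrite pow_i in H by lia.
  unfold c in H.
  replace (g (S n) 0 * t ^ S n / INR (fact (S n)))
    with (g (S n) 0 / INR (fact (S n)) * t ^ S n)
    by (field; apply INR_fact_neq_0).
  lra.
Qed.

(** * Bang's argument applied to negative parts *)

Definition log_convex (W : nat -> R) : Prop :=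
  forall n, W (S n) ^ 2 <= W n * W (S (S n)).

(** The ratios [W (S n) / W n] are nondecreasing; the cross-multiplied form avoids division. *)
Lemma log_convex_ratio_le (W : nat -> R) (n d : nat) :
  (forall p, 0 < W p) -> log_convex W ->
  W (S n) * W (n + d)%nat <= W n * W (S (n + d)).
Proof.
intros Wpos lc; induction d as [|d IH].
- rewrite Nat.add_0_r; lra.
- replace (n + S d)%nat with (S (n + d)) by lia.
  assert (H := lc (n + d)%nat).
  assert (h0 := Wpos (n + d)%nat); assert (h1 := Wpos (S (n + d))).
  assert (h2 := Wpos n).
  apply Rmult_le_reg_r with (W (n + d)%nat); [exact h0|].
  apply Rle_trans with (W n * W (S (n + d)) * W (S (n + d))).
  + replace (W (S n) * W (S (n + d)) * W (n + d)%nat)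
      with (W (S n) * W (n + d)%nat * W (S (n + d))) by ring.
    apply Rmult_le_compat_r; lra.
  + replace (W n * W (S (n + d)) * W (S (n + d))) with (W n * W (S (n + d)) ^ 2)
      by ring.
    replace (W n * W (S (S (n + d))) * W (n + d)%nat)
      with (W n * (W (n + d)%nat * W (S (S (n + d))))) by ring.
    apply Rmult_le_compat_l; lra.
Qed.

(** [N] is a level: for [n >= N] the bound follows from [|g n| <= W n], and at a fixed order it
    tends to 0 as [N] grows. [K] is the order from which signs at 0 are known. *)
Definition neg_bound (g : nat -> R -> R) (W : nat -> R) (K N : nat) (t : R) : Prop :=
  forall n, (K <= n)%nat -> - g n t <= exp (INR n - INR N) * W n.

(* One step of Bang's argument: losing a factor [e] in the bound on the
   negative parts requires moving by at least [W N / (e W (N+1))]. *)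
Lemma neg_bound_step (g : nat -> R -> R) (W : nat -> R) (K N : nat) (x y : R) :
  (forall p, 0 < W p) -> log_convex W ->
  derivative_tower g x y ->
  (forall n t, x <= t <= y -> Rabs (g n t) <= W n) ->
  x <= y -> y - x <= W N / W (S N) / exp 1 ->
  neg_bound g W K (S N) x -> neg_bound g W K N y.
Proof.
intros Wpos lc dg gW xy hxy nb.
(* By log-convexity [mu / e] is the largest ratio [W (S n) / W n] with [n <= N], and the hypothesis
   on [y - x] says [mu * (y - x) <= 1]. *)
set (mu := exp 1 * (W (S N) / W N)).
assert (e1 := exp_pos 1).
assert (w0 := Wpos N); assert (w1 := Wpos (S N)).
assert (mupos : 0 < mu).
{ apply Rmult_lt_0_compat; [lra|apply Rdiv_lt_0_compat; lra]. }
(* Above the level the exponential factor is at least 1, so the a priori bound on [g n] suffices. *)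
assert (crude : forall n t, (S N <= n)%nat -> x <= t <= y ->
          - g n t <= exp (INR n - INR (S N)) * W n).
{ intros n t hn ht.
  assert (- g n t <= W n).
  { apply Rle_trans with (Rabs (g n t)); [|now apply gW].
    rewrite <- Rabs_Ropp; apply Rle_abs. }
  assert (1 <= exp (INR n - INR (S N))).
  { rewrite <- exp_0; apply le_INR in hn.
    destruct (Req_dec (INR n) (INR (S N))) as [e|ne].
    - right; f_equal; lra.
    - left; apply exp_increasing; lra. }
  assert (hw := Wpos n); nra. }
(* Downward induction on the order, from [S N] to [K]: the bound on [- g (S n)] makes
   [A * exp (mu * (u - x)) + g n u] nondecreasing, and [nb] makes it nonnegative at [x]. *)
assert (main : forall d n, (n + d = S N)%nat -> (K <= n)%nat ->
          forall t, x <= t <= y ->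
          - g n t <= exp (INR n - INR (S N)) * W n * exp (mu * (t - x))).
{ induction d as [|d IH]; intros n nd Kn t ht.
  - assert (H := crude n t ltac:(lia) ht).
    assert (1 <= exp (mu * (t - x))).
    { rewrite <- exp_0.
      destruct (Req_dec t x) as [->|ne].
      - right; f_equal; ring.
      - left; apply exp_increasing; apply Rmult_lt_0_compat; lra. }
    assert (0 < exp (INR n - INR (S N)) * W n)
      by (apply Rmult_lt_0_compat; [apply exp_pos|apply Wpos]).
    nra.
  - set (A := exp (INR n - INR (S N)) * W n).
    assert (Apos : 0 < A)
      by (apply Rmult_lt_0_compat; [apply exp_pos|apply Wpos]).
    assert (H : A * exp (mu * (x - x)) + g n x <= A * exp (mu * (t - x)) + g n t).
    { apply derivable_pt_lim_le with
        (f := fun u => A * exp (mu * (u - x)) + g n u)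
        (f' := fun u => A * mu * exp (mu * (u - x)) + g (S n) u); [lra| |].
      - intros u hu.
        apply (derivable_pt_lim_plus (fun v => A * exp (mu * (v - x))) (g n)).
        + apply derivable_pt_lim_scal_exp.
        + apply dg; lra.
      - intros u hu.
        assert (H := IH (S n) ltac:(lia) ltac:(lia) u ltac:(lra)).
        assert (exp (INR (S n) - INR (S N)) * W (S n) <= A * mu).
        { unfold A, mu.
          replace (INR (S n) - INR (S N)) with ((INR n - INR (S N)) + 1)
            by (rewrite (S_INR n); ring).
          rewrite exp_plus.
          assert (W (S n) <= W n * (W (S N) / W N)).
          { assert (R1 := log_convex_ratio_le W n (N - n) Wpos lc).
            replace (n + (N - n))%nat with N in R1 by lia.
            apply Rmult_le_reg_r with (W N); [lra|].
            replace (W n * (W (S N) / W N) * W N) with (W n * W (S N))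
              by (field; lra).
            lra. }
          assert (0 < exp (INR n - INR (S N)) * exp 1)
            by (apply Rmult_lt_0_compat; [apply exp_pos|lra]).
          apply Rle_trans with (exp (INR n - INR (S N)) * exp 1
                                * (W n * (W (S N) / W N))).
          - apply Rmult_le_compat_l; lra.
          - right; ring. }
        assert (0 < exp (mu * (u - x))) by apply exp_pos.
        nra. }
    assert (H0 := nb n Kn).
    replace (mu * (x - x)) with 0 in H by ring.
    rewrite exp_0 in H.
    fold A in H0; lra. }
intros n Kn.
assert (wn := Wpos n).
replace (INR n - INR N) with ((INR n - INR (S N)) + 1) by (rewrite S_INR; ring).
rewrite exp_plus.
assert (0 < exp (INR n - INR (S N)) * W n)
  by (apply Rmult_lt_0_compat; [apply exp_pos|lra]).
(* Lowering the level from [S N] to [N] gains a factor [e], which absorbs [exp (mu * (y - x))] in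
   the first case. *)
destruct (le_lt_dec n (S N)) as [nN|nN].
- assert (H1 := main (S N - n)%nat n ltac:(lia) Kn y ltac:(lra)).
  assert (exp (mu * (y - x)) <= exp 1).
  { assert (mu * (y - x) <= 1).
    { apply Rle_trans with (mu * (W N / W (S N) / exp 1)).
      - apply Rmult_le_compat_l; lra.
      - right; unfold mu; field; repeat split; lra. }
    destruct (Req_dec (mu * (y - x)) 1) as [->|ne]; [lra|].
    left; apply exp_increasing; lra. }
  nra.
- assert (H1 := crude n y ltac:(lia) ltac:(lra)).
  assert (1 < exp 1) by (rewrite <- exp_0 at 1; apply exp_increasing; lra).
  nra.
Qed.

(** At 0 the negative parts vanish, so [neg_bound] holds at every level. Moving to [t] lowers the
    level, but since the sum of [W k / W (S k)] diverges, a high enough start still arrives at any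
    prescribed level. Letting that level tend to infinity removes the negative part at [t]. *)
Lemma quasianalytic_nonneg (g : nat -> R -> R) (W : nat -> R) (K : nat) (rho : R) :
  (forall p, 0 < W p) -> log_convex W -> quasianalytic W ->
  derivative_tower g 0 rho ->
  (forall n t, 0 <= t <= rho -> Rabs (g n t) <= W n) ->
  (forall n, (K <= n)%nat -> 0 <= g n 0) ->
  forall n t, (K <= n)%nat -> 0 <= t <= rho -> 0 <= g n t.
Proof.
intros Wpos lc qa dg gW g0.
set (s := sum_f_R0 (fun k => W k / W (S k))).
assert (e1 := exp_pos 1).
assert (rpos : forall k, 0 < W k / W (S k)) by (intros k; apply Rdiv_lt_0_compat; auto).
assert (sincr : forall m d, s m <= s (m + d)%nat).
{ intros m d; induction d as [|d IH].
  - rewrite Nat.add_0_r; lra.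
  - replace (m + S d)%nat with (S (m + d)) by lia.
    unfold s in *; rewrite tech5; assert (h := rpos (S (m + d))); lra. }
(* [d] counts the steps from level [S (N + d)] at 0 down to level [S N] at [t]. *)
assert (levels : forall d N t, 0 <= t <= rho ->
          t <= (s (N + d)%nat - s N) / exp 1 -> neg_bound g W K (S N) t).
{ induction d as [|d IH]; intros N t ht hs.
  - rewrite Nat.add_0_r in hs.
    replace ((s N - s N) / exp 1) with 0 in hs by (field; lra).
    assert (t = 0) as -> by lra.
    intros n Kn.
    assert (h := g0 n Kn).
    assert (0 < exp (INR n - INR (S N)) * W n)
      by (apply Rmult_lt_0_compat; [apply exp_pos|apply Wpos]).
    lra.
  - replace (N + S d)%nat with (S N + d)%nat in hs by lia.
    (* [q] is the reach of the first [d] steps; the last one starts at [Rmin t q], since [t] may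
       already lie within that reach. *)
    set (q := (s (S N + d)%nat - s (S N)) / exp 1).
    assert (q0 : 0 <= q).
    { apply Rmult_le_pos.
      - assert (h := sincr (S N) d); lra.
      - left; apply Rinv_0_lt_compat; lra. }
    assert (m1 := Rmin_l t q); assert (m2 := Rmin_r t q).
    assert (m0 : 0 <= Rmin t q) by (apply Rmin_glb; lra).
    apply neg_bound_step with (x := Rmin t q); auto.
    + intros k u hu; apply dg; lra.
    + intros k u hu; apply gW; lra.
    + assert (t <= q + W (S N) / W (S (S N)) / exp 1).
      { apply Rle_trans with (1 := hs); right.
        unfold q, s; rewrite (tech5 _ N); field.
        split; [apply Rgt_not_eq, Wpos|lra]. }
      assert (0 < W (S N) / W (S (S N)) / exp 1)
        by (apply Rdiv_lt_0_compat; auto).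
      unfold Rmin; destruct (Rle_dec t q); lra.
    + apply IH; [lra|exact m2]. }
intros n t Kn ht.
assert (small : forall N, - g n t <= exp (INR n - INR (S N)) * W n).
{ intros N.
  destruct (qa (t * exp 1 + s N)) as [L hL]; fold s in hL.
  assert (NL : (N <= L)%nat).
  { destruct (le_lt_dec N L) as [h|h]; [exact h|].
    assert (h2 := sincr L (N - L)%nat).
    replace (L + (N - L))%nat with N in h2 by lia.
    assert (0 <= t * exp 1) by (apply Rmult_le_pos; lra).
    lra. }
  apply (levels (L - N)%nat N t ht); [|exact Kn].
  replace (N + (L - N))%nat with L by lia.
  apply Rmult_le_reg_r with (exp 1); [lra|].
  replace ((s L - s N) / exp 1 * exp 1) with (s L - s N) by (field; lra).
  lra. }
apply Rnot_lt_le; intros gneg.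
assert (wn := Wpos n).
(* This [N] makes [exp (n - N - 1) * W n] smaller than [- g n t]. *)
destruct (INR_unbounded (INR n - ln (- g n t / W n))) as [N hN].
assert (h := small N).
assert (qpos : 0 < - g n t / W n) by (apply Rdiv_lt_0_compat; lra).
assert (exp (INR n - INR (S N)) < - g n t / W n).
{ rewrite <- (exp_ln (- g n t / W n)) by exact qpos.
  apply exp_increasing; rewrite S_INR; lra. }
assert (exp (INR n - INR (S N)) * W n < - g n t / W n * W n)
  by (apply Rmult_lt_compat_r; lra).
replace (- g n t / W n * W n) with (- g n t) in H0 by (field; lra).
lra.
Qed.

(** The tower starting at order [K] is nonnegative on the whole interval, so each of its Taylor
    terms at [rho] is at most [g K rho]. Replacing [(n - K)!] by [n!] only decreases the left
    side. *)
Lemma quasianalytic_taylor_bound (g : nat -> R -> R) (W : nat -> R) (K : nat)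
    (rho : R) :
  (forall p, 0 < W p) -> log_convex W -> quasianalytic W -> 0 < rho ->
  derivative_tower g 0 rho ->
  (forall n t, 0 <= t <= rho -> Rabs (g n t) <= W n) ->
  (forall n, (K <= n)%nat -> 0 <= g n 0) ->
  exists C, 0 <= C /\
    forall n, (K <= n)%nat -> g n 0 / INR (fact n) <= C * (/ rho) ^ n.
Proof.
intros Wpos lc qa rho0 dg gW g0.
assert (pos := quasianalytic_nonneg g W K rho Wpos lc qa dg gW g0).
assert (gK : 0 <= g K rho) by (apply pos; [lia|lra]).
(* The factor [rho ^ K] compensates for Taylor's formula giving only the power [n - K] of
   [/ rho]. *)
exists (g K rho * rho ^ K); split.
{ apply Rmult_le_pos; [exact gK|apply pow_le; lra]. }
intros n Kn.
assert (H := taylor_term_le (n - K) (fun k => g (K + k)%nat) rho).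
cbv beta in H.
replace (K + (n - K))%nat with n in H by lia.
rewrite Nat.add_0_r in H.
assert (H1 : g n 0 * rho ^ (n - K) / INR (fact (n - K)) <= g K rho).
{ apply H; [|intros k t ht; apply pos; [lia|lra]|lra].
  intros k t ht; rewrite Nat.add_succ_r; now apply dg. }
assert (gn := g0 n Kn).
assert (f0 := INR_fact_lt_0 n); assert (f1 := INR_fact_lt_0 (n - K)).
assert (fle : INR (fact (n - K)) <= INR (fact n)) by (apply le_INR, fact_le; lia).
assert (rn := pow_lt rho (n - K) rho0); assert (rK := pow_lt rho K rho0).
assert (H2 : g n 0 / INR (fact n) * rho ^ (n - K) <= g K rho).
{ apply Rle_trans with (2 := H1).
  replace (g n 0 / INR (fact n) * rho ^ (n - K))
    with (g n 0 * rho ^ (n - K) / INR (fact n)) by (field; lra).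
  apply Rmult_le_compat_l; [apply Rmult_le_pos; lra|].
  apply Rinv_le_contravar; lra. }
replace n with ((n - K) + K)%nat at 3 by lia.
rewrite pow_inv, pow_add.
apply Rmult_le_reg_r with (rho ^ (n - K)); [lra|].
replace (g K rho * rho ^ K * / (rho ^ (n - K) * rho ^ K) * rho ^ (n - K))
  with (g K rho) by (field; lra).
exact H2.
Qed.

(** * Log-convexity and quasianalyticity under rescaling *)

Lemma weight_sequence_log_convex (M : nat -> R) :
  weight_sequence M -> log_convex M.
Proof.
intros (_ & _ & _ & lc & _) n.
assert (H := lc (S n) ltac:(lia)).
replace (S n - 1)%nat with n in H by lia.
now replace (S n + 1)%nat with (S (S n)) in H by lia.
Qed.

Lemma log_convex_rescale (M : nat -> R) (C h : R) :
  log_convex M -> log_convex (fun n => C * (h ^ n * M n)).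
Proof.
intros lc n.
assert (H := lc n).
replace ((C * (h ^ S n * M (S n))) ^ 2)
  with ((C * h ^ S n) ^ 2 * M (S n) ^ 2) by ring.
replace (C * (h ^ n * M n) * (C * (h ^ S (S n) * M (S (S n)))))
  with ((C * h ^ S n) ^ 2 * (M n * M (S (S n)))) by (simpl; ring).
apply Rmult_le_compat_l; [apply pow2_ge_0|exact H].
Qed.

(** In the ratios of consecutive terms [C] cancels and [h] remains as a divisor. Thus the derivative
    bound of a germ can itself serve as the weight in Bang's argument. *)
Lemma quasianalytic_rescale (M : nat -> R) (C h : R) :
  (forall p, 0 < M p) -> 0 < C -> 0 < h -> quasianalytic M ->
  quasianalytic (fun n => C * (h ^ n * M n)).
Proof.
intros Mpos C0 h0 qa B.
destruct (qa (B * h)) as [n hn]; exists n.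
rewrite (sum_eq _ (fun k => M k / M (S k) * / h)).
- rewrite <- scal_sum.
  apply Rmult_lt_reg_l with h; [exact h0|].
  rewrite <- Rmult_assoc, Rinv_r, Rmult_1_l by lra.
  lra.
- intros i _.
  assert (hi := pow_lt h i h0); assert (mi := Mpos (S i)).
  simpl; field; repeat split; lra.
Qed.

(** * Restriction of germs to the first coordinate axis *)

Definition axis (k : nat) : nat -> nat := fun j => if Nat.eqb j 0 then k else 0%nat.

Lemma axis_valid (r k : nat) : (1 <= r)%nat -> valid_mi r (axis k).
Proof.
intros hr i hi; unfold axis.
destruct (Nat.eqb_spec i 0); [lia|reflexivity].
Qed.

Definition axis_index (r k : nat) (hr : (1 <= r)%nat) : mindex r :=
  exist _ (axis k) (axis_valid r k hr).

Lemma mabs_axis (r k : nat) : (1 <= r)%nat -> mabs r (axis k) = k.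
Proof.
intros hr; unfold mabs.
induction hr as [|r hr IH]; [reflexivity|].
simpl; rewrite IH; unfold axis.
destruct (Nat.eqb_spec r 0); lia.
Qed.

Lemma incr_axis (k : nat) : incr (axis k) 0 = axis (S k).
Proof.
apply functional_extensionality; intros j; unfold incr, axis.
now destruct (Nat.eqb j 0).
Qed.

Lemma upd_zero_pt_coord (t : R) (i : nat) :
  upd zero_pt 0 t i = t /\ i = 0%nat \/ upd zero_pt 0 t i = 0.
Proof.
unfold upd, zero_pt; destruct (Nat.eqb_spec i 0); auto.
Qed.

Lemma germ_axis_restriction (r k : nat) (M : nat -> R)
    (D : (nat -> nat) -> (nat -> R) -> R) :
  (1 <= r)%nat -> (forall p, 0 < M p) -> germ_class r M true k D ->
  exists rho C h, 0 < rho /\ 0 < C /\ 0 < h /\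
    derivative_tower (fun n t => D (axis n) (upd zero_pt 0 t)) 0 rho /\
    forall n t, 0 <= t <= rho ->
      Rabs (D (axis n) (upd zero_pt 0 t)) <= C * (h ^ n * M n).
Proof.
intros hr Mpos (hk & (dD & _) & bD).
assert (ik : 0 < / INR k) by (apply Rinv_0_lt_compat, lt_0_INR; lia).
destruct (bD (/ INR k / 2) ltac:(lra)) as [h [h0 [C hC]]].
(* Half the width keeps the interval compact inside the open cube; [Rabs C + 1] is a positive
   constant, as a weight needs. *)
exists (/ INR k / 2), (Rabs C + 1), h.
assert (c0 := Rabs_pos C); assert (c1 := Rle_abs C).
split; [lra|]; split; [lra|]; split; [exact h0|]; split.
- intros n t ht.
  assert (H := dD (axis n) (axis_valid r n hr) 0%nat ltac:(lia) (upd zero_pt 0 t)).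
  rewrite incr_axis in H.
  assert (cube : open_cube r (/ INR k) (upd zero_pt 0 t)).
  { intros i; destruct (upd_zero_pt_coord t i) as [[-> ->]| ->]; split; intros hi;
      try lia; try reflexivity; [rewrite Rabs_pos_eq|rewrite Rabs_R0]; lra. }
  specialize (H cube).
  intros eps he; destruct (H eps he) as [delta hd]; exists delta.
  intros u hu hu'; specialize (hd u hu hu').
  assert (E : forall v, upd (upd zero_pt 0 t) 0 v = upd zero_pt 0 v).
  { intros v; apply functional_extensionality; intros j; unfold upd.
    now destruct (Nat.eqb j 0). }
  now rewrite !E in hd.
- intros n t ht.
  apply Rle_trans with (C * (h ^ n * M n)).
  + assert (H := hC (axis n) (axis_valid r n hr) (upd zero_pt 0 t)).
    rewrite mabs_axis in H by exact hr.
    apply H; intros i.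
    destruct (upd_zero_pt_coord t i) as [[-> ->]| ->]; split; intros hi;
      try lia; try reflexivity; [rewrite Rabs_pos_eq|rewrite Rabs_R0]; lra.
  + apply Rmult_le_compat_r; [|lra].
    apply Rmult_le_pos; [apply pow_le; lra|left; apply Mpos].
Qed.

(** Taking [h = 1]. Hence jets of Roumieu germs are the only ones to exclude. *)
Lemma germ_class_beurling_roumieu (r k : nat) (M : nat -> R)
    (D : (nat -> nat) -> (nat -> R) -> R) :
  germ_class r M false k D -> germ_class r M true k D.
Proof.
intros (hk & hD & bD); split; [exact hk|]; split; [exact hD|].
intros rho hrho; exists 1; split; [lra|].
apply (bD rho hrho); lra.
Qed.

(* The sign [s] allows jets of either eventual sign. *)
Lemma jet_eventual_sign_bound (r : nat) (M : nat -> R) (b : mindex r -> R)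
    (hr : (1 <= r)%nat) (s : R) (K : nat) :
  weight_sequence M -> quasianalytic M -> in_jet_image r M true b ->
  Rabs s = 1 -> (forall n, (K <= n)%nat -> 0 <= s * b (axis_index r n hr)) ->
  exists C A, 0 <= C /\ 0 < A /\
    forall n, (K <= n)%nat -> s * b (axis_index r n hr) <= C * A ^ n.
Proof.
intros wM qM [k [D [gD ->]]] s1 sb.
assert (Mpos := proj1 wM).
destruct (germ_axis_restriction r k M D hr Mpos gD)
  as [rho [C [h [rho0 [C0 [h0 [dg gW]]]]]]].
assert (J : forall n, jet r D (axis_index r n hr)
            = D (axis n) (upd zero_pt 0 0) / INR (fact n)).
{ intros n; unfold jet; simpl; rewrite mabs_axis by exact hr.
  do 2 f_equal; apply functional_extensionality; intros j.
  unfold upd, zero_pt; now destruct (Nat.eqb j 0). }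
(* Multiplying the tower by [s] makes its derivatives at 0 nonnegative from order [K] on. *)
destruct (quasianalytic_taylor_bound
            (fun n t => s * D (axis n) (upd zero_pt 0 t))
            (fun n => C * (h ^ n * M n)) K rho) as [C' [C'0 hC']].
- intros p; apply Rmult_lt_0_compat; [exact C0|].
  apply Rmult_lt_0_compat; [now apply pow_lt|apply Mpos].
- now apply log_convex_rescale, weight_sequence_log_convex.
- now apply quasianalytic_rescale.
- exact rho0.
- intros n t ht.
  apply (derivable_pt_lim_scal (fun u => D (axis n) (upd zero_pt 0 u))).
  now apply dg.
- intros n t ht; rewrite Rabs_mult, s1, Rmult_1_l; now apply gW.
- intros n hn; specialize (sb n hn); rewrite J in sb.
  assert (f0 := INR_fact_lt_0 n).
  apply Rmult_le_reg_r with (/ INR (fact n)); [now apply Rinv_0_lt_compat|].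
  rewrite Rmult_0_l, Rmult_assoc; exact sb.
- exists C', (/ rho); split; [exact C'0|]; split; [now apply Rinv_0_lt_compat|].
  intros n hn; rewrite J; specialize (hC' n hn); cbv beta in hC'.
  unfold Rdiv in *; now rewrite <- Rmult_assoc.
Qed.

(** * Linear combinations of exponential sequences *)

Definition exps (i k : nat) : R := (2 ^ i) ^ k.

Lemma exps_pos (i k : nat) : 0 < exps i k.
Proof. unfold exps; apply pow_lt, pow_lt; lra. Qed.

(** Consecutive exponentials have quotient [2 ^ k], so a combination of the first [n] is smaller
    than the next one by that factor. *)
Lemma lincomb_exps_bound (c : nat -> R) (n : nat) :
  exists C, 0 <= C /\
    forall k, Rabs (lincomb c exps n k) * 2 ^ k <= C * exps n k.
Proof.
induction n as [|n [C [C0 IH]]].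
- exists 0; split; [lra|]; intros k; simpl; unfold vzero; rewrite Rabs_R0; lra.
- exists (C + Rabs (c n)); split; [assert (h := Rabs_pos (c n)); lra|].
  intros k; simpl.
  assert (p2 : 1 <= 2 ^ k) by (apply pow_R1_Rle; lra).
  assert (E : exps (S n) k = exps n k * 2 ^ k).
  { unfold exps; rewrite <- Rpow_mult_distr; f_equal; simpl; ring. }
  rewrite E.
  assert (T := Rabs_triang (lincomb c exps n k) (c n * exps n k)).
  rewrite Rabs_mult, (Rabs_pos_eq (exps n k)) in T by (left; apply exps_pos).
  specialize (IH k); assert (ep := exps_pos n k).
  apply Rle_trans with
    ((Rabs (lincomb c exps n k) + Rabs (c n) * exps n k) * 2 ^ k).
  + apply Rmult_le_compat_r; lra.
  + assert (C * exps n k <= C * exps n k * 2 ^ k).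
    { assert (0 <= C * exps n k) by (apply Rmult_le_pos; lra).
      nra. }
    lra.
Qed.

(** The last nonzero coefficient decides the sign. The uniform gap [eps], rather than mere
    positivity, later allows dividing by the combination. *)
Lemma lincomb_exps_sign (c : nat -> R) (n : nat) :
  (exists i, (i < n)%nat /\ c i <> 0) ->
  exists s eps K, Rabs s = 1 /\ 0 < eps /\
    forall k, (K <= k)%nat -> eps <= s * lincomb c exps n k.
Proof.
induction n as [|n IH]; intros [i [hi ci]]; [lia|].
destruct (Req_dec (c n) 0) as [cn|cn].
- destruct IH as [s [eps [K [s1 [e0 H]]]]].
  { exists i; split; [|exact ci].
    destruct (Nat.eq_dec i n) as [->|]; [contradiction|lia]. }
  exists s, eps, K; split; [exact s1|]; split; [exact e0|].
  intros k hk; simpl; rewrite cn, Rmult_0_l, Rplus_0_r; auto.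
- destruct (lincomb_exps_bound c n) as [C [C0 hC]].
  assert (a0 : 0 < Rabs (c n)) by now apply Rabs_pos_lt.
  (* From this [K] on, the lower terms amount to at most half of the leading one, whence the gap
     [Rabs (c n) / 2], as [exps n k >= 1]. *)
  destruct (Pow_x_infinity 2 ltac:(rewrite Rabs_pos_eq; lra) (2 * C / Rabs (c n)))
    as [K hK].
  assert (exists s, Rabs s = 1 /\ s * c n = Rabs (c n)) as [s [s1 sc]].
  { unfold Rabs at 2; destruct (Rcase_abs (c n)).
    - exists (-1); split; [rewrite Rabs_left; lra|lra].
    - exists 1; split; [rewrite Rabs_right; lra|lra]. }
  exists s, (Rabs (c n) / 2), K; split; [exact s1|]; split; [lra|].
  intros k hk; simpl; specialize (hK k hk); specialize (hC k).
  assert (p2 : 0 < 2 ^ k) by (apply pow_lt; lra).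
  rewrite (Rabs_pos_eq (2 ^ k)) in hK by lra.
  assert (ep : 1 <= exps n k).
  { unfold exps; apply pow_R1_Rle, pow_R1_Rle; lra. }
  assert (lower : - Rabs (lincomb c exps n k) <= s * lincomb c exps n k).
  { assert (h := Rle_abs (- (s * lincomb c exps n k))).
    rewrite Rabs_Ropp, Rabs_mult, s1 in h; lra. }
  assert (2 * C <= Rabs (c n) * 2 ^ k).
  { apply Rge_le in hK.
    apply Rmult_le_compat_l with (r := Rabs (c n)) in hK; [|lra].
    replace (Rabs (c n) * (2 * C / Rabs (c n))) with (2 * C) in hK by (field; lra).
    exact hK. }
  assert (Rabs (lincomb c exps n k) <= Rabs (c n) / 2 * exps n k).
  { apply Rmult_le_reg_r with (2 ^ k); [exact p2|].
    apply Rle_trans with (1 := hC).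
    replace (Rabs (c n) / 2 * exps n k * 2 ^ k)
      with (Rabs (c n) * 2 ^ k / 2 * exps n k) by field.
    apply Rmult_le_compat_r; lra. }
  rewrite Rmult_plus_distr_l, <- Rmult_assoc, sc.
  nra.
Qed.

(** * Spans of sequences of vectors *)

Lemma lincomb_extend {T : Type} (c : nat -> R) (v : nat -> T -> R) (n d : nat) :
  (forall i, (n <= i)%nat -> c i = 0) -> lincomb c v (n + d) = lincomb c v n.
Proof.
intros hc; induction d as [|d IH]; [now rewrite Nat.add_0_r|].
rewrite Nat.add_succ_r; simpl; rewrite IH, hc by lia.
apply functional_extensionality; intros t; ring.
Qed.

Lemma lincomb_plus {T : Type} (c c' : nat -> R) (v : nat -> T -> R) (n : nat) (t : T) :
  lincomb (fun i => c i + c' i) v n t = lincomb c v n t + lincomb c' v n t.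
Proof. induction n as [|n IH]; simpl; [unfold vzero; ring|rewrite IH; ring]. Qed.

Lemma lincomb_scal {T : Type} (a : R) (c : nat -> R) (v : nat -> T -> R)
    (n : nat) (t : T) :
  lincomb (fun i => a * c i) v n t = a * lincomb c v n t.
Proof. induction n as [|n IH]; simpl; [unfold vzero; ring|rewrite IH; ring]. Qed.

Lemma lincomb_delta {T : Type} (v : nat -> T -> R) (i : nat) :
  lincomb (fun j => if Nat.eqb j i then 1 else 0) v (S i) = v i.
Proof.
assert (H : forall n, (n <= i)%nat ->
          lincomb (fun j => if Nat.eqb j i then 1 else 0) v n = vzero).
{ induction n as [|n IH]; intros hn; [reflexivity|].
  simpl; rewrite IH by lia.
  destruct (Nat.eqb_spec n i); [lia|].
  apply functional_extensionality; intros t; unfold vzero; ring. }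
simpl; rewrite H by lia; rewrite Nat.eqb_refl.
apply functional_extensionality; intros t; unfold vzero; ring.
Qed.

(** Requiring [c] to vanish from [n] on lets two combinations be rewritten with a common length. *)
Definition finite_span {T : Type} (v : nat -> T -> R) (u : T -> R) : Prop :=
  exists c n, (forall i, (n <= i)%nat -> c i = 0) /\ u = lincomb c v n.

Lemma finite_span_subspace {T : Type} (v : nat -> T -> R) :
  is_subspace (finite_span v).
Proof.
split; [|split].
- now exists (fun _ => 0), 0%nat.
- intros u u' [c [n [hc ->]]] [c' [n' [hc' ->]]].
  exists (fun i => c i + c' i), (n + n')%nat; split.
  + intros i hi; rewrite hc, hc' by lia; ring.
  + apply functional_extensionality; intros t.
    rewrite lincomb_plus, (lincomb_extend c) by exact hc.
    now rewrite (Nat.add_comm n), (lincomb_extend c') by exact hc'.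
- intros a u [c [n [hc ->]]].
  exists (fun i => a * c i), n; split.
  + intros i hi; rewrite hc by exact hi; ring.
  + apply functional_extensionality; intros t; now rewrite lincomb_scal.
Qed.

Lemma finite_span_infinite_dim {T : Type} (v : nat -> T -> R) :
  (forall n, lin_indep v n) -> infinite_dim (finite_span v).
Proof.
intros ind n; exists v; split; [|apply ind].
intros i _; exists (fun j => if Nat.eqb j i then 1 else 0), (S i); split.
- intros j hj; destruct (Nat.eqb_spec j i); [lia|reflexivity].
- now rewrite lincomb_delta.
Qed.

(** * Jets supported on the first axis *)

(* For [r >= 1], [|a| = a_0] holds exactly when [a] is a multiple of [e_1]. *)
Definition axis_seq (r : nat) (w : nat -> R) (u : nat -> R) : mindex r -> R :=
  fun al => let a := proj1_sig al in
    if Nat.eqb (mabs r a) (a 0%nat) then w (a 0%nat) * u (a 0%nat) else 0.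

Lemma axis_seq_index (r n : nat) (hr : (1 <= r)%nat) (w u : nat -> R) :
  axis_seq r w u (axis_index r n hr) = w n * u n.
Proof.
unfold axis_seq; simpl; rewrite mabs_axis by exact hr.
unfold axis; simpl; now rewrite Nat.eqb_refl.
Qed.

Lemma lincomb_axis_seq (r : nat) (w : nat -> R) (c : nat -> R)
    (u : nat -> nat -> R) (n : nat) :
  lincomb c (fun i => axis_seq r w (u i)) n = axis_seq r w (lincomb c u n).
Proof.
induction n as [|n IH]; apply functional_extensionality; intros al.
- unfold axis_seq, vzero; simpl; destruct (Nat.eqb _ _); unfold vzero; ring.
- simpl; rewrite IH; unfold axis_seq; destruct (Nat.eqb _ _); ring.
Qed.

(** Entries off the axis are 0, so the bound on the axis extends to them because [C] is
    nonnegative. *)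
Lemma axis_seq_Lambda (r : nat) (N w u : nat -> R) (roum : bool) :
  (forall p, 0 < N p) ->
  quant_h roum (fun h => exists C, 0 <= C /\
    forall k, Rabs (w k * u k) <= C * (h ^ k * msmall N k)) ->
  Lambda r N roum (axis_seq r w u).
Proof.
intros Npos H.
assert (main : forall h, 0 < h ->
  (exists C, 0 <= C /\ forall k, Rabs (w k * u k) <= C * (h ^ k * msmall N k)) ->
  exists C, forall al : mindex r,
    Rabs (axis_seq r w u al) <=
      C * (h ^ mabs r (proj1_sig al) * msmall N (mabs r (proj1_sig al)))).
{ intros h h0 [C [C0 hC]]; exists C; intros al; unfold axis_seq.
  destruct (Nat.eqb_spec (mabs r (proj1_sig al)) (proj1_sig al 0%nat)) as [->|ne].
  - apply hC.
  - rewrite Rabs_R0.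
    apply Rmult_le_pos; [exact C0|].
    apply Rmult_le_pos; [apply pow_le; lra|].
    left; apply Rdiv_lt_0_compat; [apply Npos|apply INR_fact_lt_0]. }
destruct roum; simpl in *.
- destruct H as [h [h0 H]]; exists h; auto.
- intros h h0; auto.
Qed.

(** * Geometric growth and the roots of [msmall N] *)

(** The finitely many initial terms are absorbed one at a time by enlarging the constant. *)
Lemma geometric_bound_from_start (w : nat -> R) (K : nat) (C A : R) :
  0 < A -> (forall k, (K <= k)%nat -> w k <= C * A ^ k) ->
  exists C', 0 <= C' /\ forall k, w k <= C' * A ^ k.
Proof.
intros A0; revert C; induction K as [|K IH]; intros C H.
- exists (Rabs C); split; [apply Rabs_pos|]; intros k.
  apply Rle_trans with (1 := H k ltac:(lia)).
  apply Rmult_le_compat_r; [apply pow_le; lra|apply Rle_abs].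
- apply (IH (Rmax C (w K / A ^ K))); intros k hk.
  assert (p := pow_lt A k A0).
  destruct (Nat.eq_dec k K) as [->|ne].
  + apply Rle_trans with (w K / A ^ K * A ^ K); [right; field; lra|].
    apply Rmult_le_compat_r; [lra|apply Rmax_r].
  + apply Rle_trans with (1 := H k ltac:(lia)).
    apply Rmult_le_compat_r; [lra|apply Rmax_l].
Qed.

Lemma msmall_pos (N : nat -> R) (k : nat) : (forall p, 0 < N p) -> 0 < msmall N k.
Proof. intros Npos; apply Rdiv_lt_0_compat; [apply Npos|apply INR_fact_lt_0]. Qed.

Lemma pow_mroot (N : nat -> R) (k : nat) :
  (forall p, 0 < N p) -> (1 <= k)%nat -> mroot N k ^ k = msmall N k.
Proof.
intros Npos hk; unfold mroot.
rewrite <- Rpower_pow by apply exp_pos.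
rewrite Rpower_mult, Rinv_l by (apply not_0_INR; lia).
apply Rpower_1, msmall_pos, Npos.
Qed.

Lemma pow_lt_compat_base (a b : R) (k : nat) :
  0 <= a < b -> (1 <= k)%nat -> a ^ k < b ^ k.
Proof.
intros hab hk; induction hk as [|k hk IH]; [simpl; lra|].
simpl; apply Rmult_le_0_lt_compat; try lra; apply pow_le; lra.
Qed.

(** A bound [C' * A ^ k] would keep all the roots below [(C' + 1) * A], because [C' <= (C' + 1) ^ k]
    for [k >= 1]. *)
Lemma mroot_unbounded_not_geometric (N : nat -> R) (K : nat) (C A : R) :
  (forall p, 0 < N p) ->
  (forall B : R, exists k : nat, (1 <= k)%nat /\ B < mroot N k) ->
  0 < A -> ~ (forall k, (K <= k)%nat -> msmall N k <= C * A ^ k).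
Proof.
intros Npos unb A0 H.
destruct (geometric_bound_from_start _ K C A A0 H) as [C' [C0 H']].
destruct (unb ((C' + 1) * A)) as [k [hk hB]].
assert (0 <= (C' + 1) * A) by (apply Rmult_le_pos; lra).
assert (L := pow_lt_compat_base ((C' + 1) * A) (mroot N k) k ltac:(lra) hk).
rewrite pow_mroot, Rpow_mult_distr in L by assumption.
specialize (H' k).
assert (C' <= (C' + 1) ^ k).
{ apply Rle_trans with ((C' + 1) ^ 1); [simpl; lra|].
  apply Rle_pow; [lra|exact hk]. }
assert (p := pow_lt A k A0).
assert (C' * A ^ k <= (C' + 1) ^ k * A ^ k) by (apply Rmult_le_compat_r; lra).
lra.
Qed.

(** * Lineability in the Roumieu and Beurling cases *)

(** Common core of both cases. The conditions on [w] pull in opposite directions: it outgrows every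
    geometric sequence, which excludes jets of germs, yet times any [Q ^ k] it stays within the
    growth allowed by [Lambda]. *)
Lemma lineable_weighted_exps (r : nat) (M N w : nat -> R) (roum : bool) :
  (1 <= r)%nat -> weight_sequence M -> quasianalytic M -> (forall p, 0 < N p) ->
  (forall k, 0 < w k) ->
  (forall K C A, 0 < A -> ~ (forall k, (K <= k)%nat -> w k <= C * A ^ k)) ->
  (forall Q, 0 < Q -> quant_h roum (fun h => exists C, 0 <= C /\
     forall k, w k * Q ^ k <= C * (h ^ k * msmall N k))) ->
  forall roum', lineable (fun b => Lambda r N roum b /\ ~ in_jet_image r M roum' b).
Proof.
intros hr wM qM Npos wpos wdiv wN roum'.
exists (finite_span (fun i => axis_seq r w (exps i))).
split; [apply finite_span_subspace|]; split.
- apply finite_span_infinite_dim; intros n c hc i hi.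
  apply NNPP; intros ci.
  (* A nontrivial combination is nonzero at order [K], and so is its product with [w K]. *)
  destruct (lincomb_exps_sign c n) as [s [eps [K [_ [e0 H]]]]]; [now exists i|].
  specialize (H K (Nat.le_refl K)).
  rewrite lincomb_axis_seq in hc.
  apply (f_equal (fun u => u (axis_index r K hr))) in hc.
  rewrite axis_seq_index in hc; unfold vzero in hc.
  assert (wK := wpos K).
  apply Rmult_integral in hc; destruct hc as [hc|hc]; [lra|].
  rewrite hc in H; lra.
- intros b [c [n [_ ->]]]; rewrite lincomb_axis_seq.
  destruct (classic (exists i, (i < n)%nat /\ c i <> 0)) as [nz|nz].
  + left; split.
    * apply axis_seq_Lambda; [exact Npos|].
      destruct (lincomb_exps_bound c n) as [B [B0 hB]].
      (* The single base [Q = 2 ^ n] dominates all the exponentials of the combination. *)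
      assert (ub : forall h, 0 < h -> (exists C, 0 <= C /\
                forall k, w k * (2 ^ n) ^ k <= C * (h ^ k * msmall N k)) ->
              exists C, 0 <= C /\ forall k,
                Rabs (w k * lincomb c exps n k) <= C * (h ^ k * msmall N k)).
      { intros h h0 [C [C0 hC]]; exists (B * C).
        split; [apply Rmult_le_pos; lra|]; intros k.
        assert (wk := wpos k).
        rewrite Rabs_mult, (Rabs_pos_eq (w k)) by lra.
        assert (Rabs (lincomb c exps n k) <= B * exps n k).
        { apply Rle_trans with (2 := hB k).
          assert (p := pow_R1_Rle 2 k ltac:(lra)).
          assert (a := Rabs_pos (lincomb c exps n k)); nra. }
        apply Rle_trans with (B * (w k * (2 ^ n) ^ k)).
        - fold (exps n k).
          apply Rle_trans with (w k * (B * exps n k)); [|right; ring].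
          apply Rmult_le_compat_l; lra.
        - rewrite Rmult_assoc; apply Rmult_le_compat_l; [exact B0|apply hC]. }
      assert (wQ := wN (2 ^ n) ltac:(apply pow_lt; lra)).
      destruct roum; simpl in *.
      -- destruct wQ as [h [h0 hh]]; exists h; auto.
      -- intros h h0; auto.
    * intros img.
      assert (img' : in_jet_image r M true (axis_seq r w (lincomb c exps n))).
      { destruct roum'; [exact img|].
        destruct img as [k [D [gD e]]]; exists k, D.
        split; [now apply germ_class_beurling_roumieu|exact e]. }
      destruct (lincomb_exps_sign c n nz) as [s [eps [K [s1 [e0 H]]]]].
      destruct (jet_eventual_sign_bound r M _ hr s K wM qM img' s1)
        as [C [A [C0 [A0 hb]]]].
      { intros k hk; rewrite axis_seq_index.
        specialize (H k hk); assert (wk := wpos k).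
        replace (s * (w k * lincomb c exps n k))
          with (w k * (s * lincomb c exps n k)) by ring.
        apply Rmult_le_pos; lra. }
      (* Since [s * lincomb c exps n k >= eps], the geometric bound on the jet passes to [w] at the
         cost of a factor [/ eps]. *)
      apply (wdiv K (C / eps) A A0); intros k hk.
      specialize (hb k hk); rewrite axis_seq_index in hb.
      specialize (H k hk); assert (wk := wpos k).
      apply Rmult_le_reg_r with eps; [exact e0|].
      replace (C / eps * A ^ k * eps) with (C * A ^ k) by (field; lra).
      apply Rle_trans with (2 := hb).
      replace (s * (w k * lincomb c exps n k))
        with (w k * (s * lincomb c exps n k)) by ring.
      apply Rmult_le_compat_l; lra.
  + right; rewrite <- lincomb_axis_seq.
    assert (Z : forall m, (m <= n)%nat ->
              lincomb c (fun i => axis_seq r w (exps i)) m = vzero).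
    { induction m as [|m IH]; intros hm; [reflexivity|].
      simpl; rewrite IH by lia.
      assert (c m = 0) as ->.
      { apply NNPP; intros cm; apply nz; exists m; split; [lia|exact cm]. }
      apply functional_extensionality; intros t; unfold vzero; ring. }
    now apply Z.
Qed.

(** After division by [h ^ k * msmall N k], the claim is that [(Q / h) ^ k / sqrt (msmall N k)] is
    bounded; it is at most 1 once [mroot N k] exceeds [(Q / h) ^ 2]. *)
Lemma sqrt_msmall_dominates (N : nat -> R) (Q h : R) :
  (forall p, 0 < N p) ->
  (forall B : R, exists K : nat, forall k : nat, (K <= k)%nat -> (1 <= k)%nat ->
      B < mroot N k) ->
  0 < Q -> 0 < h ->
  exists C, 0 <= C /\
    forall k, sqrt (msmall N k) * Q ^ k <= C * (h ^ k * msmall N k).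
Proof.
intros Npos lim Q0 h0.
assert (Qh : 0 < Q / h) by (apply Rdiv_lt_0_compat; lra).
destruct (lim ((Q / h) ^ 2)) as [K hK].
destruct (geometric_bound_from_start
            (fun k => (Q / h) ^ k / sqrt (msmall N k)) (S K) 1 1) as [C [C0 hC]];
  [lra| |].
- intros k hk; rewrite pow1.
  assert (L := pow_lt_compat_base ((Q / h) ^ 2) (mroot N k) k
                 ltac:(split; [apply pow2_ge_0|apply hK; lia]) ltac:(lia)).
  rewrite pow_mroot in L by (assumption || lia).
  assert (m0 := msmall_pos N k Npos).
  assert (s0 := sqrt_lt_R0 _ m0).
  assert (p := pow_lt _ k Qh).
  assert ((Q / h) ^ k <= sqrt (msmall N k)).
  { rewrite <- (sqrt_pow2 ((Q / h) ^ k)) by lra.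
    apply sqrt_le_1_alt.
    rewrite <- pow_mult, Nat.mul_comm, pow_mult; lra. }
  apply Rmult_le_reg_r with (sqrt (msmall N k)); [exact s0|].
  replace ((Q / h) ^ k / sqrt (msmall N k) * sqrt (msmall N k)) with ((Q / h) ^ k)
    by (field; lra).
  lra.
- exists C; split; [exact C0|]; intros k.
  specialize (hC k); cbv beta in hC; rewrite pow1, Rmult_1_r in hC.
  assert (m0 := msmall_pos N k Npos).
  assert (s0 := sqrt_lt_R0 _ m0).
  assert (hk := pow_lt h k h0).
  assert (E : sqrt (msmall N k) * Q ^ k =
          (Q / h) ^ k / sqrt (msmall N k) * (h ^ k * msmall N k)).
  { rewrite <- (sqrt_sqrt (msmall N k)) at 3 by lra.
    unfold Rdiv; rewrite Rpow_mult_distr, pow_inv; field; lra. }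
  rewrite E; apply Rmult_le_compat_r; [|exact hC].
  apply Rmult_le_pos; lra.
Qed.

Theorem mainTheorem7 (r : nat) (M N : nat -> R) :
  (1 <= r)%nat ->
  weight_sequence M -> weight_sequence N ->
  quasianalytic M -> quasianalytic N ->
  (* Roumieu case *)
  ((forall B : R, exists k : nat, (1 <= k)%nat /\ B < mroot N k) ->
     lineable (fun b => Lambda r N true b /\ ~ in_jet_image r M true b) /\
     lineable (fun b => Lambda r N true b /\ ~ in_jet_image r M false b)) /\
  (* Beurling case *)
  ((forall B : R, exists K : nat, forall k : nat, (K <= k)%nat -> (1 <= k)%nat ->
        B < mroot N k) ->
     lineable (fun b => Lambda r N false b /\ ~ in_jet_image r M true b) /\
     lineable (fun b => Lambda r N false b /\ ~ in_jet_image r M false b)).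
Proof.
intros hr wM [Npos _] qM _; split.
- intros unb.
  assert (H : forall roum',
            lineable (fun b => Lambda r N true b /\ ~ in_jet_image r M roum' b)).
  { apply (lineable_weighted_exps r M N (msmall N)); auto.
    - intros k; now apply msmall_pos.
    - intros K C A A0; now apply mroot_unbounded_not_geometric.
    (* In the Roumieu case [h = Q] and [C = 1] turn the required bound into an equality. *)
    - intros Q Q0; exists Q; split; [exact Q0|].
      exists 1; split; [lra|]; intros k; right; ring. }
  split; apply H.
- intros lim.
  assert (H : forall roum',
            lineable (fun b => Lambda r N false b /\ ~ in_jet_image r M roum' b)).
  { apply (lineable_weighted_exps r M N (fun k => sqrt (msmall N k))); auto.
    - intros k; now apply sqrt_lt_R0, msmall_pos.
    - intros K C A A0 H.
      (* Squaring a geometric bound on [sqrt (msmall N k)] gives one on [msmall N k]. *)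
      apply (mroot_unbounded_not_geometric N K (C * C) (A * A) Npos).
      + intros B; destruct (lim B) as [k hk]; exists (S k).
        split; [lia|apply hk; lia].
      + now apply Rmult_lt_0_compat.
      + intros k hk; specialize (H k hk).
        assert (m0 := msmall_pos N k Npos).
        assert (s0 := sqrt_lt_R0 _ m0).
        rewrite <- (sqrt_sqrt (msmall N k)) by lra.
        rewrite Rpow_mult_distr.
        replace (C * C * (A ^ k * A ^ k)) with (C * A ^ k * (C * A ^ k)) by ring.
        apply Rmult_le_compat; lra.
    - intros Q Q0 h h0; now apply sqrt_msmall_dominates. }
  split; apply H.
Qed.
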